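(* Let $\Omega\subset\mathbb{C}$ be open and let $\mathcal{F}$ be a locally bounded family in $\mathcal{A}(\Omega)$. Then: (a) $\mathcal{F}$ is equicontinuous on each compact subset of $\Omega$. (b) (Montel's Theorem) $\mathcal{F}$ is normal.
   Context: A function on an open set $\Omega\subset\mathbb{C}$ is analytic if around each $z_0\in\Omega$ it is given on some open disk centered at $z_0$ and contained in $\Omega$ by a convergent power series in $z-z_0$; $\mathcal{A}(\Omega)$ is the set of analytic functions in $\Omega$. A family $\mathcal{F}$ of continuous functions $\Omega\to\mathbb{C}$ is: locally bounded if for every $z_0\in\Omega$ there exist an open disk $D(z_0;r)$ (contained in $\Omega$) and a finite constant $M$ such that $|f(z)|\le M$ for all $f\in\mathcal{F}$ and all $z\in D(z_0;r)$; equicontinuous on $X\subset\Omega$ if for every $\epsilon>0$ there exists $\delta>0$ such that $|f(z)-f(w)|<\epsilon$ for all $f\in\mathcal{F}$ and all $z,w\in X$ with $|z-w|<\delta$; normal if every sequence in $\mathcal{F}$ contains a subsequence converging uniformly on every compact subset of $\Omega$ to some function $f:\Omega\to\mathbb{C}$ (which is not required to belong to $\mathcal{F}$). *)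

(* Defs.v *)
From Stdlib Require Import Reals List.
From Coquelicot Require Import Coquelicot.

Open Scope R_scope.

Definition subset (A B : C -> Prop) : Prop := forall z : C, A z -> B z.

(* Written with [Cmod], because Coquelicot's [ball] on [C] is a square (sup
   norm of the product [R * R]).  The induced topologies agree, so Coquelicot's
   [open] on [C] is the usual notion (see [locally_C]). *)
Definition disk (z0 : C) (r : R) (z : C) : Prop := Cmod (z - z0)%C < r.

Definition compact_set (K : C -> Prop) : Prop :=
  forall U : (C -> Prop) -> Prop,
    (forall V : C -> Prop, U V -> open V) ->
    (forall z : C, K z -> exists V : C -> Prop, U V /\ V z) ->
    exists l : list (C -> Prop),
      (forall V : C -> Prop, In V l -> U V) /\
      (forall z : C, K z -> exists V : C -> Prop, In V l /\ V z).

(* Functions on [Omega] are represented by total functions [C -> C]; all the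
   notions below only look at their values on [Omega]. *)

Definition analytic (Omega : C -> Prop) (f : C -> C) : Prop :=
  forall z0 : C, Omega z0 ->
    exists r : R, 0 < r /\ subset (disk z0 r) Omega /\
      exists a : nat -> C,
        forall z : C, disk z0 r z -> is_pseries a (z - z0)%C (f z).

Definition locally_bounded (Omega : C -> Prop) (F : (C -> C) -> Prop) : Prop :=
  forall z0 : C, Omega z0 ->
    exists r M : R, 0 < r /\ subset (disk z0 r) Omega /\
      forall (f : C -> C) (z : C), F f -> disk z0 r z -> Cmod (f z) <= M.

Definition equicontinuous_on (X : C -> Prop) (F : (C -> C) -> Prop) : Prop :=
  forall eps : R, 0 < eps ->
    exists delta : R, 0 < delta /\
      forall (f : C -> C) (z w : C), F f -> X z -> X w ->
        Cmod (z - w)%C < delta -> Cmod (f z - f w)%C < eps.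

Definition converges_uniformly_on (K : C -> Prop) (u : nat -> C -> C)
    (f : C -> C) : Prop :=
  forall eps : R, 0 < eps ->
    exists N : nat, forall (n : nat) (z : C), (N <= n)%nat -> K z ->
      Cmod (u n z - f z)%C < eps.

Definition normal (Omega : C -> Prop) (F : (C -> C) -> Prop) : Prop :=
  forall u : nat -> C -> C, (forall n : nat, F (u n)) ->
    exists (phi : nat -> nat) (f : C -> C),
      (forall n : nat, (phi n < phi (S n))%nat) /\
      forall K : C -> Prop, compact_set K -> subset K Omega ->
        converges_uniformly_on K (fun n => u (phi n)) f.

(* Main.v *)
Require Import Defs.
From Stdlib Require Import Reals List ZArith Cantor Lra Lia ClassicalEpsilon.
From Coquelicot Require Import Coquelicot.

(** Equicontinuity comes from a Lipschitz estimate that is uniform in the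
    family: if [f] is analytic and bounded by [M] on the disk of radius [r]
    about [z0], then [|f z - f w| <= (8 M / r) |z - w|] on the concentric disk
    of radius [r / 2] ([analytic_lipschitz]).  To see this, fix [w] and
    consider the difference quotient [g z = (f z - f w) / (z - w)], with the
    derivative of [f] as its value at [w].  On the circle of radius [3 r / 4]
    the numerator is at most [2 M] and the denominator at least [r / 4], so
    [|g| <= 8 M / r] there, and the maximum modulus principle carries the
    bound to the inside.

    The maximum modulus principle ([maximum_modulus]) needs only the local
    shape of [g]: near every point [z1], either [g] is constant or
    [g z = g z1 + c (z - z1)^k + O(|z - z1|^(k+1))] with [k >= 1] and
    [c <> 0].  In the second case some [k]-th power direction makes [|g|]
    strictly increase ([modulus_exceeded_nearby]), so [z1] is not a maximizer.
    In the first case the points near [z1] but further from the center are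
    maximizers too, so among all maximizers of [|g|] on the closed disk, one
    at the greatest distance from the center must lie on the circle.  For
    analytic [f] the required shape is read off the first nonvanishing
    coefficient of the power series ([pseries_tail_order]), and it survives
    division by [z - w]; thus [g] itself never has to be expanded in a series.

    Part (a) then follows by covering the compact set with disks on which the
    family oscillates by less than [eps].  Part (b) is the Arzela-Ascoli
    argument ([Arzela_Ascoli]): a diagonal subsequence converges at every
    point of a countable dense grid, local equicontinuity makes it uniformly
    Cauchy near every point, and compactness makes it uniformly Cauchy on each
    compact subset. *)

(** * Moduli, disks and powers *)

Lemma Cmod_minus_sym (x y : C) : Cmod (x - y)%C = Cmod (y - x)%C.
Proof. replace (x - y)%C with (- (y - x))%C by ring. apply Cmod_opp. Qed.

Lemma Cmod_minus_triangle (x y z : C) :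
  Cmod (x - z)%C <= Cmod (x - y)%C + Cmod (y - z)%C.
Proof. replace (x - z)%C with ((x - y) + (y - z))%C by ring. apply Cmod_triangle. Qed.

Lemma Cmod_le_minus (x y : C) : Cmod x <= Cmod y + Cmod (x - y)%C.
Proof. replace x with (y + (x - y))%C at 1 by ring. apply Cmod_triangle. Qed.

Lemma Cmod_minus_abs (x y : C) : Rabs (Cmod x - Cmod y) <= Cmod (x - y)%C.
Proof.
  pose proof (Cmod_le_minus x y) as H1. pose proof (Cmod_le_minus y x) as H2.
  rewrite (Cmod_minus_sym y x) in H2. apply Rabs_le_between. lra.
Qed.

Lemma Cmod_le_Re_Im (z : C) : Cmod z <= Rabs (Re z) + Rabs (Im z).
Proof.
  assert (E : z = (RtoC (Re z) + RtoC (Im z) * Ci)%C).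
  { destruct z as [x y]. unfold Cplus, Cmult, RtoC, Ci, Re, Im; simpl. f_equal; ring. }
  rewrite E at 1. eapply Rle_trans; [apply Cmod_triangle|].
  rewrite Cmod_mult, Cmod_Ci, !Cmod_R, Rmult_1_r. apply Rle_refl.
Qed.

Lemma Im_le_Cmod (z : C) : Rabs (Im z) <= Cmod z.
Proof. eapply Rle_trans; [apply Rmax_r | apply Rmax_Cmod]. Qed.

Lemma disk_center (z : C) (r : R) : 0 < r -> disk z r z.
Proof.
  intros Hr; unfold disk. replace (z - z)%C with (RtoC 0) by ring.
  now rewrite Cmod_0.
Qed.

Lemma open_disk (z0 : C) (r : R) : open (disk z0 r).
Proof.
  intros z Hz. unfold disk in Hz.
  assert (Hpos : 0 < r - Cmod (z - z0)%C) by lra.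
  apply (locally_le_locally_norm (V := C_NormedModule) z (disk z0 r)).
  exists (mkposreal _ Hpos). intros w Hw. change (Cmod (w - z)%C < r - Cmod (z - z0)%C) in Hw.
  unfold disk. pose proof (Cmod_minus_triangle w z z0). lra.
Qed.

Lemma pow_antitone (t : R) (i j : nat) :
  0 <= t <= 1 -> (i <= j)%nat -> t ^ j <= t ^ i.
Proof.
  intros Ht Hij. replace j with (i + (j - i))%nat by lia. rewrite pow_add.
  rewrite <- (Rmult_1_r (t ^ i)) at 2. apply Rmult_le_compat_l; [apply pow_le; lra|].
  rewrite <- (pow1 (j - i)). apply pow_incr; lra.
Qed.

Lemma inv_INR_lt (eps : R) :
  0 < eps -> exists N, forall n, (N <= n)%nat -> / (INR n + 1) < eps.
Proof.
  intros He. destruct (archimed_cor1 eps He) as [N [HN HN0]].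
  exists N. intros n Hn. eapply Rle_lt_trans; [|exact HN].
  apply Rinv_le_contravar; [now apply lt_0_INR|].
  apply le_INR in Hn. lra.
Qed.

(** * Power series expansions and order of vanishing *)

Lemma pow_n_Cpow (z : C) (n : nat) : @pow_n C_Ring z n = (z ^ n)%C.
Proof. induction n as [|n IH]; simpl; [reflexivity | now rewrite IH]. Qed.

Definition partial_sum (a : nat -> C) (x : C) (n : nat) : C :=
  @sum_n C_AbelianMonoid (fun j => a j * x ^ j)%C n.

Lemma partial_sum_S (a : nat -> C) (x : C) (n : nat) :
  partial_sum a x (S n) = (partial_sum a x n + a (S n) * x ^ S n)%C.
Proof. unfold partial_sum. now rewrite sum_Sn. Qed.

Lemma is_pseries_partial_sum (a : nat -> C) (x l : C) :
  @is_pseries C_AbsRing C_NormedModule a x l ->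
  filterlim (partial_sum a x) eventually (@locally C_NormedModule l).
Proof.
  intros H. eapply filterlim_ext; [|exact H].
  intros n; unfold partial_sum. apply sum_n_ext; intros k.
  rewrite pow_n_Cpow. apply Cmult_comm.
Qed.

Lemma is_pseries_approx (a : nat -> C) (x l : C) (eps : R) (m : nat) :
  @is_pseries C_AbsRing C_NormedModule a x l -> 0 < eps ->
  exists n, (m <= n)%nat /\ Cmod (l - partial_sum a x n)%C < eps.
Proof.
  intros H He. apply is_pseries_partial_sum in H.
  destruct (proj1 (filterlim_locally_ball_norm (U := C_NormedModule) _ l) H
              (mkposreal eps He)) as [N HN].
  exists (N + m)%nat; split; [lia|].
  rewrite Cmod_minus_sym. apply (HN (N + m)%nat). lia.
Qed.

Lemma is_pseries_terms_bounded (a : nat -> C) (x l : C) :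
  @is_pseries C_AbsRing C_NormedModule a x l ->
  exists A, 0 <= A /\ forall n, Cmod (a n) * Cmod x ^ n <= A.
Proof.
  intros H. apply is_pseries_partial_sum in H.
  destruct (filterlim_bounded (V := C_NormedModule) _ (ex_intro _ l H)) as [M HM].
  change (forall n, Cmod (partial_sum a x n) <= M) in HM.
  assert (HM0 : 0 <= M) by (eapply Rle_trans; [apply Cmod_ge_0 | apply (HM O)]).
  exists (M + M); split; [lra|]. intros n.
  rewrite <- Cmod_pow, <- Cmod_mult. destruct n as [|n].
  - specialize (HM O). unfold partial_sum in HM. rewrite sum_O in HM. lra.
  - replace (a (S n) * x ^ S n)%C with (partial_sum a x (S n) + - partial_sum a x n)%C
      by (rewrite partial_sum_S; ring).
    eapply Rle_trans; [apply Cmod_triangle|]. rewrite Cmod_opp.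
    pose proof (HM n); pose proof (HM (S n)); lra.
Qed.

(** Comparison with the geometric series of ratio [Cmod x / s <= 1 / 2].  The
    factor [2 - 2 (1 / 2)^m] is the sum of the first [m] powers of [1 / 2]; this
    exact form is what makes the induction on [m] close. *)
Lemma partial_sum_tail_bound (a : nat -> C) (x : C) (A s : R) (k m : nat) :
  0 < s -> (forall n, Cmod (a n) * s ^ n <= A) -> Cmod x <= s / 2 ->
  Cmod (partial_sum a x (k + m) - partial_sum a x k)%C
    <= A * (Cmod x / s) ^ S k * (2 - 2 * (1 / 2) ^ m).
Proof.
  intros Hs HA Hx. pose proof (Cmod_ge_0 x) as Hx0.
  set (q := Cmod x / s).
  assert (Hq0 : 0 <= q) by (apply Rdiv_le_0_compat; lra).
  assert (Hq : q <= 1 / 2).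
  { unfold q. apply (Rmult_le_reg_r s); [lra|]. field_simplify; lra. }
  assert (HA0 : 0 <= A).
  { eapply Rle_trans; [|apply (HA O)].
    simpl. rewrite Rmult_1_r. apply Cmod_ge_0. }
  induction m as [|m IH].
  - rewrite Nat.add_0_r.
    replace (partial_sum a x k - partial_sum a x k)%C with (RtoC 0) by ring.
    rewrite Cmod_0. simpl; lra.
  - rewrite Nat.add_succ_r, partial_sum_S.
    replace (partial_sum a x (k + m) + a (S (k + m)) * x ^ S (k + m) - partial_sum a x k)%C
      with ((partial_sum a x (k + m) - partial_sum a x k) + a (S (k + m)) * x ^ S (k + m))%C
      by ring.
    eapply Rle_trans; [apply Cmod_triangle|].
    rewrite Cmod_mult, Cmod_pow.
    assert (Hterm : Cmod (a (S (k + m))) * Cmod x ^ S (k + m)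
              <= A * q ^ S k * (1 / 2) ^ m).
    { replace (Cmod x) with (s * q) by (unfold q; field; lra).
      rewrite Rpow_mult_distr, <- Rmult_assoc.
      replace (q ^ S (k + m)) with (q ^ S k * q ^ m)
        by (rewrite <- pow_add; f_equal; lia).
      rewrite <- Rmult_assoc.
      apply Rmult_le_compat.
      - apply Rmult_le_pos; [|now apply pow_le].
        apply Rmult_le_pos; [apply Cmod_ge_0 | apply pow_le; lra].
      - now apply pow_le.
      - apply Rmult_le_compat_r; [now apply pow_le | apply HA].
      - apply pow_incr; lra. }
    simpl ((1 / 2) ^ S m). lra.
Qed.

(** The terms of the series are bounded at distance [r / 2] from the center,
    since it converges there; within [r / 4] the ratio to that radius is at most
    [1 / 2], and the tail after degree [k] is a geometric series. *)
Lemma pseries_remainder (a : nat -> C) (f : C -> C) (z0 : C) (r : R) :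
  0 < r ->
  (forall z, disk z0 r z ->
     @is_pseries C_AbsRing C_NormedModule a (z - z0)%C (f z)) ->
  forall k, exists B, forall z, disk z0 (r / 4) z ->
    Cmod (f z - partial_sum a (z - z0)%C k)%C <= B * Cmod (z - z0)%C ^ S k.
Proof.
  intros Hr Hf k.
  assert (Hz : Cmod (z0 + RtoC (r / 2) - z0)%C = r / 2).
  { replace (z0 + RtoC (r / 2) - z0)%C with (RtoC (r / 2)) by ring.
    rewrite Cmod_R. apply Rabs_pos_eq; lra. }
  destruct (is_pseries_terms_bounded a _ _
              (Hf (z0 + RtoC (r / 2))%C ltac:(unfold disk; lra))) as [A [HA0 HA]].
  rewrite Hz in HA.
  exists (2 * A / (r / 2) ^ S k). intros z Hzr. unfold disk in Hzr.
  set (x := (z - z0)%C) in *.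
  assert (Hpow : 0 < (r / 2) ^ S k) by (apply pow_lt; lra).
  replace (2 * A / (r / 2) ^ S k * Cmod x ^ S k) with (2 * (A * (Cmod x / (r / 2)) ^ S k))
    by (change (Cmod x / (r / 2)) with (Cmod x * / (r / 2));
        rewrite Rpow_mult_distr, pow_inv; field; lra).
  assert (H0 : 0 <= A * (Cmod x / (r / 2)) ^ S k).
  { apply Rmult_le_pos; [lra|]. apply pow_le.
    apply Rdiv_le_0_compat; [apply Cmod_ge_0 | lra]. }
  apply le_epsilon. intros eps He.
  destruct (is_pseries_approx a x (f z) eps k
              (Hf z ltac:(unfold disk; fold x; lra)) He) as [n [Hn Happ]].
  eapply Rle_trans; [apply (Cmod_minus_triangle _ (partial_sum a x n))|].
  replace n with (k + (n - k))%nat in * by lia.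
  pose proof (partial_sum_tail_bound a x A (r / 2) k (n - k) ltac:(lra) HA ltac:(lra)).
  assert (0 < (1 / 2) ^ (n - k)) by (apply pow_lt; lra).
  set (t := A * (Cmod x / (r / 2)) ^ S k) in *. nra.
Qed.

Definition leading_term (h : C -> C) (z1 : C) (k : nat) (c : C) : Prop :=
  exists B delta : R, 0 < delta /\ forall z, disk z1 delta z ->
    Cmod (h z - c * (z - z1) ^ k)%C <= B * Cmod (z - z1)%C ^ S k.

(** The dichotomy satisfied by an analytic germ whose Taylor coefficients below
    degree [m] vanish.  Unlike a power series expansion it passes to the quotient
    by [z - w] with elementary estimates, which is why difference quotients
    are handled through it. *)
Definition has_order_from (m : nat) (h : C -> C) (z1 : C) : Prop :=
  (exists delta, 0 < delta /\ forall z, disk z1 delta z -> h z = RtoC 0) \/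
  (exists k c, (m <= k)%nat /\ c <> RtoC 0 /\ leading_term h z1 k c).

Lemma has_order_from_ext_near (m : nat) (h h' : C -> C) (z1 : C) (r : R) :
  0 < r -> (forall z, disk z1 r z -> h z = h' z) ->
  has_order_from m h z1 -> has_order_from m h' z1.
Proof.
  intros Hr E Hh.
  assert (Hsplit : forall d z, disk z1 (Rmin d r) z -> disk z1 d z /\ h z = h' z).
  { intros d z Hz. unfold disk in *. split.
    - eapply Rlt_le_trans; [exact Hz | apply Rmin_l].
    - apply E. eapply Rlt_le_trans; [exact Hz | apply Rmin_r]. }
  destruct Hh as [[d [Hd H]] | [k [c [Hk [Hc [B [d [Hd H]]]]]]]].
  - left. exists (Rmin d r). split; [now apply Rmin_glb_lt|]. intros z Hz.
    destruct (Hsplit d z Hz) as [Hzd <-]. now apply H.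
  - right. exists k, c. repeat split; try assumption.
    exists B, (Rmin d r). split; [now apply Rmin_glb_lt|]. intros z Hz.
    destruct (Hsplit d z Hz) as [Hzd <-]. now apply H.
Qed.

Lemma has_order_from_ext (m : nat) (h h' : C -> C) (z1 : C) :
  (forall z, h z = h' z) -> has_order_from m h z1 -> has_order_from m h' z1.
Proof.
  intros E. apply (has_order_from_ext_near m h h' z1 1); [lra | auto].
Qed.

Lemma partial_sum_zero_coeffs (a : nat -> C) (x : C) (m n : nat) :
  (m <= n)%nat -> (forall j, (m < j <= n)%nat -> a j = RtoC 0) ->
  partial_sum a x n = partial_sum a x m.
Proof.
  intros Hmn; induction Hmn as [|n Hmn IH]; intros H; [reflexivity|].
  rewrite partial_sum_S, IH, (H (S n)) by (try (intros; apply H); lia). ring.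
Qed.

(** Either all coefficients beyond degree [m] vanish, or the first nonzero one
    gives the leading term, by the remainder estimate at that degree. *)
Lemma pseries_tail_order (a : nat -> C) (f : C -> C) (z1 : C) (r : R) (m : nat) :
  0 < r ->
  (forall z, disk z1 r z ->
     @is_pseries C_AbsRing C_NormedModule a (z - z1)%C (f z)) ->
  has_order_from (S m) (fun z => f z - partial_sum a (z - z1) m)%C z1.
Proof.
  intros Hr Hf.
  destruct (classic (exists k, (m < k)%nat /\ a k <> RtoC 0)) as [Hex | Hno].
  - right. destruct (dec_inh_nat_subset_has_unique_least_element _ (fun n => classic _) Hex)
      as [k [[[Hk Hak] Hmin] _]].
    exists k, (a k). split; [lia|]. split; [assumption|].
    destruct (pseries_remainder a f z1 r Hr Hf k) as [B HB].
    exists B, (r / 4). split; [lra|]. intros z Hz.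
    replace (f z - partial_sum a (z - z1) m - a k * (z - z1) ^ k)%C
      with (f z - partial_sum a (z - z1) k)%C; [now apply HB|].
    destruct k as [|k]; [lia|].
    rewrite partial_sum_S, (partial_sum_zero_coeffs a _ m k); [ring | lia |].
    intros j Hj. apply NNPP. intros Hne.
    assert (S k <= j)%nat by (apply Hmin; split; [lia | assumption]). lia.
  - left. exists r. split; [assumption|]. intros z Hz.
    apply Cmod_eq_0, Rle_antisym; [|apply Cmod_ge_0].
    apply le_epsilon. intros eps He.
    destruct (is_pseries_approx a _ (f z) eps m (Hf z Hz) He) as [n [Hn Happ]].
    rewrite (partial_sum_zero_coeffs a _ m n Hn) in Happ; [lra|].
    intros j Hj. apply NNPP. intros Hne. apply Hno. exists j. split; [lia | assumption].
Qed.

(** The linear term dominates everything of order at least 2, unless [d = 0]. *)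
Lemma has_order_from_add_linear (h : C -> C) (z1 d : C) :
  has_order_from 2 h z1 ->
  has_order_from 1 (fun z => h z + d * (z - z1))%C z1.
Proof.
  intros Hh. destruct (classic (d = RtoC 0)) as [-> | Hd].
  { apply (has_order_from_ext 1 h); [intros z; ring|].
    destruct Hh as [H | [k [c [Hk H]]]]; [now left|].
    right. exists k, c. split; [lia | assumption]. }
  right. exists 1%nat, d. split; [lia|]. split; [assumption|].
  destruct Hh as [[del [Hdel H]] | [k [c [Hk [Hc [B [del [Hdel H]]]]]]]].
  - exists 0, del. split; [assumption|]. intros z Hz. rewrite H by assumption.
    replace (0 + d * (z - z1) - d * (z - z1) ^ 1)%C with (RtoC 0) by (simpl; ring).
    rewrite Cmod_0. lra.
  - exists (Rabs B + Cmod c), (Rmin del 1).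
    split; [apply Rmin_glb_lt; lra|]. intros z Hz. unfold disk in Hz.
    assert (Hz1 : Cmod (z - z1)%C < del) by (eapply Rlt_le_trans; [exact Hz | apply Rmin_l]).
    assert (Hz2 : Cmod (z - z1)%C < 1) by (eapply Rlt_le_trans; [exact Hz | apply Rmin_r]).
    replace (h z + d * (z - z1) - d * (z - z1) ^ 1)%C
      with ((h z - c * (z - z1) ^ k) + c * (z - z1) ^ k)%C by (simpl; ring).
    eapply Rle_trans; [apply Cmod_triangle|]. rewrite Cmod_mult, Cmod_pow.
    specialize (H z Hz1). set (t := Cmod (z - z1)%C) in *.
    assert (Ht : 0 <= t) by apply Cmod_ge_0.
    pose proof (pow_antitone t 2 k ltac:(lra) Hk).
    pose proof (pow_antitone t 2 (S k) ltac:(lra) ltac:(lia)).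
    pose proof (pow_le t (S k) Ht).
    pose proof (Cmod_ge_0 c). pose proof (Rle_abs B). pose proof (Rabs_pos B).
    eapply Rle_trans; [apply Rplus_le_compat_r, H|].
    rewrite Rmult_plus_distr_r. apply Rplus_le_compat.
    + apply Rle_trans with (Rabs B * t ^ S k).
      * apply Rmult_le_compat_r; lra.
      * apply Rmult_le_compat_l; lra.
    + apply Rmult_le_compat_l; lra.
Qed.

(** The factor [1 / (z - w)] is [1 / (z1 - w) + O(|z - z1|)]: it multiplies the
    leading coefficient by [1 / (z1 - w)] and leaves the order unchanged. *)
Lemma has_order_from_div_away (m : nat) (h : C -> C) (z1 w : C) :
  z1 <> w -> has_order_from m h z1 ->
  has_order_from m (fun z => h z / (z - w))%C z1.
Proof.
  intros Hw [[del [Hdel H]] | [k [c [Hk [Hc [B [del [Hdel H]]]]]]]].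
  { left. exists del. split; [assumption|]. intros z Hz. rewrite H by assumption.
    unfold Cdiv. ring. }
  right. pose proof (Cminus_eq_contra _ _ Hw) as Hne.
  exists k, (c / (z1 - w))%C. split; [assumption|]. split.
  { intros E. apply Hc. replace c with (c / (z1 - w) * (z1 - w))%C by (field; assumption).
    rewrite E. ring. }
  set (d := Cmod (z1 - w)%C).
  assert (Hd : 0 < d) by (now apply Cmod_gt_0).
  exists (Rabs B * (2 / d) + Cmod c / d * (2 / d)), (Rmin del (d / 2)).
  split; [apply Rmin_glb_lt; lra|]. intros z Hz. unfold disk in Hz.
  assert (Hz1 : Cmod (z - z1)%C < del) by (eapply Rlt_le_trans; [exact Hz | apply Rmin_l]).
  assert (Hz2 : Cmod (z - z1)%C < d / 2) by (eapply Rlt_le_trans; [exact Hz | apply Rmin_r]).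
  assert (Hzw : d / 2 <= Cmod (z - w)%C).
  { pose proof (Cmod_minus_triangle z1 z w) as T. rewrite (Cmod_minus_sym z1 z) in T.
    fold d in T. lra. }
  assert (Hne' : (z - w)%C <> RtoC 0) by (apply Cmod_gt_0; lra).
  replace (h z / (z - w) - c / (z1 - w) * (z - z1) ^ k)%C
    with ((h z - c * (z - z1) ^ k) / (z - w)
          + - (c / (z1 - w) * ((z - z1) ^ S k / (z - w))))%C
    by (rewrite Cpow_S; field; split; assumption).
  eapply Rle_trans; [apply Cmod_triangle|].
  rewrite Cmod_opp, Cmod_mult, !Cmod_div, Cmod_pow by assumption. fold d.
  assert (Hinv : / Cmod (z - w)%C <= 2 / d).
  { replace (2 / d) with (/ (d / 2)) by (field; lra). apply Rinv_le_contravar; lra. }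
  assert (Hinv0 : 0 < / Cmod (z - w)%C) by (apply Rinv_0_lt_compat; lra).
  specialize (H z Hz1). pose proof (Cmod_ge_0 (z - z1)%C) as Ht.
  set (t := Cmod (z - z1)%C) in *. assert (0 <= t ^ S k) by (now apply pow_le).
  rewrite Rmult_plus_distr_r. apply Rplus_le_compat.
  - apply Rle_trans with (Rabs B * t ^ S k * (2 / d)); [|lra].
    unfold Rdiv at 1. apply Rmult_le_compat; [apply Cmod_ge_0 | lra | | assumption].
    eapply Rle_trans; [exact H|]. apply Rmult_le_compat_r; [assumption | apply Rle_abs].
  - rewrite Rmult_assoc. apply Rmult_le_compat_l.
    + apply Rdiv_le_0_compat; [apply Cmod_ge_0 | assumption].
    + rewrite (Rmult_comm (2 / d)). now apply Rmult_le_compat_l.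
Qed.

(** Division by [z - z1] lowers the order by one.  The point [z = z1] itself
    causes no trouble: since [m >= 1], both [h] and the quotient by [0] take the
    value [0] there. *)
Lemma has_order_from_div_here (m : nat) (h : C -> C) (z1 : C) :
  (1 <= m)%nat -> has_order_from (S m) h z1 ->
  has_order_from m (fun z => h z / (z - z1))%C z1.
Proof.
  intros Hm [[del [Hdel H]] | [k [c [Hk [Hc [B [del [Hdel H]]]]]]]].
  { left. exists del. split; [assumption|]. intros z Hz. rewrite H by assumption.
    unfold Cdiv. ring. }
  right. destruct k as [|k]; [lia|].
  exists k, c. split; [lia|]. split; [assumption|].
  exists B, del. split; [assumption|]. intros z Hz. specialize (H z Hz).
  destruct (classic (z = z1)) as [-> | Hne].
  - replace (z1 - z1)%C with (RtoC 0) in * by ring.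
    assert (E0 : forall j, (RtoC 0 ^ S j)%C = RtoC 0) by (intros j; rewrite Cpow_S; ring).
    rewrite E0 in H. rewrite Cmod_0, !pow_i, Rmult_0_r in * by lia.
    replace (h z1 - c * 0)%C with (h z1) in H by ring.
    assert (Eh : h z1 = RtoC 0) by (apply Cmod_eq_0, Rle_antisym; [assumption | apply Cmod_ge_0]).
    destruct k as [|k]; [lia|]. rewrite Eh, E0.
    replace (0 / 0 - c * 0)%C with (RtoC 0) by (unfold Cdiv; ring).
    rewrite Cmod_0; lra.
  - pose proof (Cminus_eq_contra _ _ Hne) as Hz0.
    assert (Ht : 0 < Cmod (z - z1)%C) by (now apply Cmod_gt_0).
    replace (h z / (z - z1) - c * (z - z1) ^ k)%C
      with ((h z - c * (z - z1) ^ S k) / (z - z1))%C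
      by (rewrite Cpow_S; field; assumption).
    rewrite Cmod_div by assumption.
    apply (Rmult_le_reg_r (Cmod (z - z1)%C)); [assumption|].
    replace (Cmod (h z - c * (z - z1) ^ S k)%C / Cmod (z - z1)%C * Cmod (z - z1)%C)
      with (Cmod (h z - c * (z - z1) ^ S k)%C) by (field; lra).
    simpl in *. lra.
Qed.

(** * Local growth of the modulus *)

Lemma unit_circle_pow (t : R) (n : nat) :
  ((cos t, sin t) ^ n)%C = (cos (INR n * t), sin (INR n * t)).
Proof.
  induction n as [|n IH].
  - rewrite Rmult_0_l, cos_0, sin_0. reflexivity.
  - rewrite Cpow_S, IH, S_INR, Rmult_plus_distr_r, Rmult_1_l, cos_plus, sin_plus.
    unfold Cmult; simpl. f_equal; ring.
Qed.

Lemma Cmod_unit_circle (t : R) : Cmod (cos t, sin t) = 1.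
Proof.
  unfold Cmod; simpl. rewrite !Rmult_1_r.
  replace (cos t * cos t + sin t * sin t) with 1; [apply sqrt_1|].
  pose proof (sin2_cos2 t) as H. unfold Rsqr in H. lra.
Qed.

(** The [k]-th powers of unit numbers fill the circle; it is enough to reach
    [1], [-1], [i] and [-i], one of which rotates [c] into the right half
    plane. *)
Lemma unit_power_half_plane (c : C) (k : nat) :
  (1 <= k)%nat -> c <> RtoC 0 ->
  exists u : C, Cmod u = 1 /\ 0 < Re (c * u ^ k)%C.
Proof.
  intros Hk Hc. assert (Hk0 : INR k <> 0) by (apply not_0_INR; lia).
  destruct c as [x y].
  assert (Hdir : forall s, 0 < x * cos s - y * sin s ->
            exists u : C, Cmod u = 1 /\ 0 < Re ((x, y) * u ^ k)%C).
  { intros s Hs. exists (cos (s / INR k), sin (s / INR k)).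
    split; [apply Cmod_unit_circle|].
    rewrite unit_circle_pow. replace (INR k * (s / INR k)) with s by (field; assumption).
    exact Hs. }
  destruct (Rtotal_order x 0) as [Hx | [Hx | Hx]].
  - apply (Hdir PI). rewrite cos_PI, sin_PI. lra.
  - destruct (Rtotal_order y 0) as [Hy | [Hy | Hy]].
    + apply (Hdir (PI / 2)). rewrite cos_PI2, sin_PI2. lra.
    + exfalso. apply Hc. now rewrite Hx, Hy.
    + apply (Hdir (- (PI / 2))). rewrite cos_neg, sin_neg, cos_PI2, sin_PI2. lra.
  - apply (Hdir 0). rewrite cos_0, sin_0. lra.
Qed.

(** When [A <> 0], choose [u] so that [c u^k] has a positive component [m] in
    the direction of [A]; projecting [A + t c u^k] on that direction gives the
    linear lower bound. *)
Lemma modulus_increasing_direction (A c : C) (k : nat) :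
  (1 <= k)%nat -> c <> RtoC 0 ->
  exists (u : C) (m : R), Cmod u = 1 /\ 0 < m /\
    forall t, 0 <= t -> Cmod A + t * m <= Cmod (A + RtoC t * (c * u ^ k))%C.
Proof.
  intros Hk Hc. destruct (classic (A = RtoC 0)) as [-> | HA].
  - exists (RtoC 1), (Cmod c). split; [apply Cmod_1|].
    split; [now apply Cmod_gt_0|]. intros t Ht.
    rewrite Cpow_1_l, Cplus_0_l, !Cmod_mult, Cmod_0, Cmod_1, Cmod_R, Rabs_pos_eq by assumption.
    lra.
  - assert (HA0 : 0 < Cmod A) by (now apply Cmod_gt_0).
    assert (HAc : (Cconj A * c)%C <> RtoC 0).
    { apply Cmult_neq_0; [|assumption]. apply Cmod_gt_0. now rewrite Cmod_conj. }
    destruct (unit_power_half_plane _ k Hk HAc) as [u [Hu Hre]].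
    set (mu := Re (Cconj A * c * u ^ k)%C) in *.
    exists u, (mu / Cmod A). split; [assumption|].
    split; [now apply Rdiv_lt_0_compat|]. intros t Ht.
    apply (Rmult_le_reg_l (Cmod A)); [assumption|].
    rewrite <- (Cmod_conj A) at 4. rewrite <- Cmod_mult.
    eapply Rle_trans; [|eapply Rle_trans; [apply Rle_abs | apply re_le_Cmod]].
    replace (Cconj A * (A + RtoC t * (c * u ^ k)))%C
      with (A * Cconj A + RtoC t * (Cconj A * c * u ^ k))%C by ring.
    rewrite <- Cmod2_conj.
    replace (Re (RtoC (Cmod A ^ 2) + RtoC t * (Cconj A * c * u ^ k))%C)
      with (Cmod A ^ 2 + t * mu).
    + right. field. lra.
    + unfold mu.
      destruct (Cconj A * c * u ^ k)%C as [p q]. unfold Re, RtoC, Cplus, Cmult; simpl. ring.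
Qed.

(** In a good direction [u], moving by [s] gains at least [m s^k] from the
    leading term and loses at most [|B| s^(k+1)] to the error, a net gain for
    small [s]. *)
Lemma modulus_exceeded_nearby (g : C -> C) (z1 : C) (k : nat) (c : C) (eps : R) :
  (1 <= k)%nat -> c <> RtoC 0 ->
  leading_term (fun z => g z - g z1)%C z1 k c -> 0 < eps ->
  exists z, disk z1 eps z /\ Cmod (g z1) < Cmod (g z).
Proof.
  intros Hk Hc [B [del [Hdel H]]] He.
  destruct (modulus_increasing_direction (g z1) c k Hk Hc) as [u [m [Hu [Hm Hinc]]]].
  pose proof (Rabs_pos B) as HB.
  assert (Hq : 0 < m / (Rabs B + 1)) by (apply Rdiv_lt_0_compat; lra).
  set (s := Rmin (Rmin del eps) (m / (Rabs B + 1)) / 2).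
  assert (Hmin : 0 < Rmin (Rmin del eps) (m / (Rabs B + 1))) by (repeat apply Rmin_glb_lt; lra).
  pose proof (Rmin_l (Rmin del eps) (m / (Rabs B + 1))).
  pose proof (Rmin_r (Rmin del eps) (m / (Rabs B + 1))).
  pose proof (Rmin_l del eps). pose proof (Rmin_r del eps).
  assert (Hs : 0 < s) by (unfold s; lra).
  assert (Hs3 : Rabs B * s < m).
  { assert (Hlt : s < m / (Rabs B + 1)) by (unfold s; lra).
    apply (Rmult_lt_compat_r (Rabs B + 1)) in Hlt; [|lra].
    replace (m / (Rabs B + 1) * (Rabs B + 1)) with m in Hlt by (field; lra). lra. }
  assert (Hmod : Cmod (z1 + RtoC s * u - z1)%C = s).
  { replace (z1 + RtoC s * u - z1)%C with (RtoC s * u)%C by ring.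
    rewrite Cmod_mult, Hu, Cmod_R, Rabs_pos_eq; lra. }
  exists (z1 + RtoC s * u)%C. unfold disk in *. rewrite Hmod. split; [unfold s; lra|].
  specialize (H (z1 + RtoC s * u)%C). rewrite Hmod in H.
  specialize (H ltac:(unfold s; lra)).
  set (G := g (z1 + RtoC s * u)%C) in *.
  replace (z1 + RtoC s * u - z1)%C with (RtoC s * u)%C in H by ring.
  assert (Hsk : 0 < s ^ k) by (now apply pow_lt).
  specialize (Hinc (s ^ k) ltac:(lra)).
  pose proof (Cmod_le_minus (g z1 + RtoC (s ^ k) * (c * u ^ k))%C G) as T.
  rewrite Cmod_minus_sym in T.
  replace (G - (g z1 + RtoC (s ^ k) * (c * u ^ k)))%C
    with (G - g z1 - c * (RtoC s * u) ^ k)%C in T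
    by (rewrite Cpow_mult_l, RtoC_pow; ring).
  pose proof (Rle_abs B). simpl in H.
  assert (B * (s * s ^ k) <= s ^ k * (Rabs B * s)).
  { replace (s ^ k * (Rabs B * s)) with (Rabs B * (s * s ^ k)) by ring.
    apply Rmult_le_compat_r; [|assumption]. apply Rmult_le_pos; lra. }
  assert (s ^ k * (Rabs B * s) < s ^ k * m) by (now apply Rmult_lt_compat_l).
  lra.
Qed.

Lemma has_order_from_continuous (h : C -> C) (z1 : C) (eps : R) :
  has_order_from 1 h z1 -> 0 < eps ->
  exists delta, 0 < delta /\ forall z, disk z1 delta z -> Cmod (h z) < eps.
Proof.
  intros [[del [Hdel H]] | [k [c [Hk [Hc [B [del [Hdel H]]]]]]]] He.
  { exists del. split; [assumption|]. intros z Hz. rewrite H, Cmod_0; assumption. }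
  pose proof (Rabs_pos B) as HB. pose proof (Cmod_ge_0 c) as Hc0.
  set (K := Rabs B + Cmod c + 1).
  assert (Hq : 0 < eps / K) by (apply Rdiv_lt_0_compat; unfold K; lra).
  exists (Rmin (Rmin del 1) (eps / K)).
  split; [repeat apply Rmin_glb_lt; lra|]. intros z Hz. unfold disk in *.
  pose proof (Rmin_l (Rmin del 1) (eps / K)). pose proof (Rmin_r (Rmin del 1) (eps / K)).
  pose proof (Rmin_l del 1). pose proof (Rmin_r del 1).
  specialize (H z ltac:(lra)). pose proof (Cmod_ge_0 (z - z1)%C) as Ht.
  pose proof (Cmod_le_minus (h z) (c * (z - z1) ^ k)%C) as T.
  rewrite Cmod_mult, Cmod_pow in T. set (t := Cmod (z - z1)%C) in *.
  pose proof (pow_antitone t 1 k ltac:(lra) Hk) as Hpk.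
  pose proof (pow_antitone t 1 (S k) ltac:(lra) ltac:(lia)) as HpSk.
  rewrite pow_1 in Hpk, HpSk. pose proof (pow_le t (S k) Ht). pose proof (Rle_abs B).
  assert (B * t ^ S k <= Rabs B * t).
  { apply Rle_trans with (Rabs B * t ^ S k).
    - apply Rmult_le_compat_r; lra.
    - apply Rmult_le_compat_l; lra. }
  assert (Cmod c * t ^ k <= Cmod c * t) by (apply Rmult_le_compat_l; lra).
  assert (Hlt : t < eps / K) by lra.
  apply (Rmult_lt_compat_r K) in Hlt; [|unfold K; lra].
  replace (eps / K * K) with eps in Hlt by (field; unfold K; lra).
  unfold K in Hlt. nra.
Qed.

(** * Subsequences *)

Definition extraction (phi : nat -> nat) : Prop := forall n, (phi n < phi (S n))%nat.

Definition seq_limit (u : nat -> C) (l : C) : Prop :=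
  forall eps, 0 < eps -> exists N, forall n, (N <= n)%nat -> Cmod (u n - l)%C < eps.

Lemma extraction_lt (phi : nat -> nat) (n m : nat) :
  extraction phi -> (n < m)%nat -> (phi n < phi m)%nat.
Proof.
  intros H Hnm. induction Hnm as [|m Hnm IH]; [apply H|].
  specialize (H m). lia.
Qed.

Lemma extraction_ge (phi : nat -> nat) (n : nat) : extraction phi -> (n <= phi n)%nat.
Proof.
  intros H. induction n as [|n IH]; [lia|]. specialize (H n). lia.
Qed.

Lemma extraction_comp (phi psi : nat -> nat) :
  extraction phi -> extraction psi -> extraction (fun n => phi (psi n)).
Proof. intros H1 H2 n. apply extraction_lt; [assumption | apply H2]. Qed.

Lemma extract_frequently (P : nat -> nat -> Prop) :
  (forall m N, exists p, (N <= p)%nat /\ P m p) ->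
  exists phi, extraction phi /\ forall n, P n (phi n).
Proof.
  intros H.
  destruct (choice (fun mN p => (snd mN <= p)%nat /\ P (fst mN) p)
              (fun mN => H (fst mN) (snd mN))) as [pick Hpick].
  set (phi := fix phi n := match n with
                           | O => pick (O, O)
                           | S n => pick (S n, S (phi n)) end).
  exists phi. split.
  - intros n. destruct (Hpick (S n, S (phi n))) as [Hle _]. exact Hle.
  - intros [|n]; [apply (Hpick (O, O)) | apply (Hpick (S n, S (phi n)))].
Qed.

Lemma bounded_R_subsequence (u : nat -> R) (M : R) :
  (forall n, Rabs (u n) <= M) ->
  exists phi l, extraction phi /\
    forall eps, 0 < eps -> exists N, forall n, (N <= n)%nat -> Rabs (u (phi n) - l) < eps.
Proof.
  intros HM.
  destruct (Bolzano_Weierstrass u (fun x => - M <= x <= M) (compact_P3 (- M) M)) as [l Hl].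
  { intros n. apply Rabs_le_between, HM. }
  destruct (extract_frequently (fun m p => Rabs (u p - l) < / (INR m + 1))) as [phi [Hphi H]].
  { intros m N. assert (Hpos : 0 < / (INR m + 1)).
    { apply Rinv_0_lt_compat. pose proof (pos_INR m). lra. }
    apply (Hl (fun x => Rabs (x - l) < / (INR m + 1)) N).
    exists (mkposreal _ Hpos). intros x Hx. exact Hx. }
  exists phi, l. split; [assumption|]. intros eps He.
  destruct (inv_INR_lt eps He) as [N HN]. exists N. intros n Hn.
  eapply Rlt_trans; [apply H | now apply HN].
Qed.

Lemma bounded_C_subsequence (u : nat -> C) (M : R) :
  (forall n, Cmod (u n) <= M) ->
  exists phi l, extraction phi /\ seq_limit (fun n => u (phi n)) l.
Proof.
  intros HM.
  destruct (bounded_R_subsequence (fun n => Re (u n)) M) as [phi [x [Hphi Hx]]].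
  { intros n. eapply Rle_trans; [apply re_le_Cmod | apply HM]. }
  destruct (bounded_R_subsequence (fun n => Im (u (phi n))) M) as [psi [y [Hpsi Hy]]].
  { intros n. eapply Rle_trans; [apply Im_le_Cmod | apply HM]. }
  exists (fun n => phi (psi n)), (x, y). split; [now apply extraction_comp|].
  intros eps He.
  destruct (Hx (eps / 2) ltac:(lra)) as [N1 H1].
  destruct (Hy (eps / 2) ltac:(lra)) as [N2 H2].
  exists (Nat.max N1 N2). intros n Hn.
  specialize (H1 (psi n) ltac:(pose proof (extraction_ge psi n Hpsi); lia)).
  specialize (H2 n ltac:(lia)).
  eapply Rle_lt_trans; [apply Cmod_le_Re_Im|].
  unfold Re, Im, Cminus, Cplus, Copp in *; simpl. unfold Rminus in *. lra.
Qed.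

(** Iterated extraction: [Phi (S j)] refines [Phi j] so that the sequence [v (S j)]
    converges along it.  From rank [j] on, the diagonal [Phi n n] runs through
    [Phi j] at indices at least [n], so [v j] converges along it for every [j]. *)
Lemma diagonal_subsequence (v : nat -> nat -> C) :
  (forall j, exists M, forall n, Cmod (v j n) <= M) ->
  exists phi, extraction phi /\ forall j, exists l, seq_limit (fun n => v j (phi n)) l.
Proof.
  intros Hv.
  assert (Hsub : forall u : nat -> C, exists phi, extraction phi /\
            ((exists M, forall n, Cmod (u n) <= M) ->
             exists l, seq_limit (fun n => u (phi n)) l)).
  { intros u. destruct (classic (exists M, forall n, Cmod (u n) <= M)) as [[M HM] | Hno].
    - destruct (bounded_C_subsequence u M HM) as [phi [l [Hphi Hl]]].
      exists phi. split; [assumption|]. intros _. now exists l.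
    - exists (fun n => n). split; [intros n; apply Nat.lt_succ_diag_r|]. intros H. now elim Hno. }
  destruct (choice _ Hsub) as [sub Hs].
  set (Phi := fix Phi j : nat -> nat :=
         match j with
         | O => sub (v O)
         | S j => fun n => Phi j (sub (fun i => v (S j) (Phi j i)) n)
         end).
  assert (Hext : forall j, extraction (Phi j)).
  { induction j as [|j IH]; simpl; [apply Hs | apply extraction_comp; [assumption | apply Hs]]. }
  assert (Hlim : forall j, exists l, seq_limit (fun n => v j (Phi j n)) l).
  { intros [|j]; [apply (proj2 (Hs (v O))), Hv|].
    apply (proj2 (Hs (fun i => v (S j) (Phi j i)))).
    destruct (Hv (S j)) as [M HM]. exists M. intros n. apply HM. }
  assert (Hnest : forall j d n, exists p, (n <= p)%nat /\ Phi (d + j)%nat n = Phi j p).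
  { intros j d. induction d as [|d IH]; intros n; [now exists n|]. simpl.
    set (psi := sub _).
    destruct (IH (psi n)) as [p [Hp E]]. exists p. split; [|assumption].
    eapply Nat.le_trans; [apply (extraction_ge psi); apply Hs | exact Hp]. }
  exists (fun n => Phi n n). split.
  - intros n. simpl. apply extraction_lt; [apply Hext|].
    eapply Nat.lt_le_trans; [apply Nat.lt_succ_diag_r | apply extraction_ge; apply Hs].
  - intros j. destruct (Hlim j) as [l Hl]. exists l. intros eps He.
    destruct (Hl eps He) as [N HN]. exists (Nat.max N j). intros n Hn.
    destruct (Hnest j (n - j)%nat n) as [p [Hp E]].
    replace (n - j + j)%nat with n in E by lia. rewrite E. apply HN. lia.
Qed.

(** * The maximum modulus principle *)

Definition seq_compact (X : C -> Prop) : Prop :=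
  forall u : nat -> C, (forall n, X (u n)) ->
    exists phi l, extraction phi /\ X l /\ seq_limit (fun n => u (phi n)) l.

Definition continuous_on (X : C -> Prop) (h : C -> R) : Prop :=
  forall z, X z -> forall eps, 0 < eps ->
    exists delta, 0 < delta /\
      forall w, X w -> disk z delta w -> Rabs (h w - h z) < eps.

(** The supremum is taken of [atan (h z)], which is bounded whether or not [h]
    is; since [atan] is increasing, a maximizing sequence for it is one for
    [h], and [h] is maximal at the limit of a subsequence. *)
Lemma seq_compact_maximum (X : C -> Prop) (h : C -> R) :
  seq_compact X -> continuous_on X h -> (exists z, X z) ->
  exists z, X z /\ forall w, X w -> h w <= h z.
Proof.
  intros HX Hh [z0 Hz0].
  destruct (completeness (fun y => exists z, X z /\ y = atan (h z))) as [s [Hub Hlub]].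
  { exists (PI / 2). intros y [z [_ ->]]. left. apply atan_bound. }
  { now exists (atan (h z0)), z0. }
  assert (Hseq : forall n, exists z, X z /\ s - / (INR n + 1) < atan (h z)).
  { intros n. apply NNPP. intros Hno.
    assert (Hpos : 0 < / (INR n + 1)).
    { apply Rinv_0_lt_compat. pose proof (pos_INR n). lra. }
    assert (s <= s - / (INR n + 1)); [|lra].
    apply Hlub. intros y [z [Hz ->]]. apply Rnot_lt_le. intros Hlt.
    apply Hno. now exists z. }
  destruct (choice _ Hseq) as [u Hu].
  destruct (HX u (fun n => proj1 (Hu n))) as [phi [l [Hphi [Hl Hlim]]]].
  exists l. split; [assumption|]. intros w Hw. apply Rnot_lt_le. intros Hlt.
  set (y := (h l + h w) / 2).
  assert (Hgap : 0 < s - atan y).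
  { assert (atan y < atan (h w)) by (apply atan_increasing; unfold y; lra).
    assert (atan (h w) <= s) by (apply Hub; now exists w). lra. }
  destruct (Hh l Hl ((h w - h l) / 2) ltac:(lra)) as [del [Hdel Hcont]].
  destruct (Hlim del Hdel) as [N1 HN1]. destruct (inv_INR_lt _ Hgap) as [N2 HN2].
  set (n := Nat.max N1 N2).
  pose proof (Hcont (u (phi n)) (proj1 (Hu _)) (HN1 n ltac:(lia))) as Hc.
  apply Rabs_lt_between in Hc.
  assert (atan (h (u (phi n))) < atan y) by (apply atan_increasing; unfold y; lra).
  pose proof (proj2 (Hu (phi n))).
  pose proof (HN2 (phi n) ltac:(pose proof (extraction_ge phi n Hphi); lia)). lra.
Qed.

Lemma seq_compact_level (X : C -> Prop) (h : C -> R) (y : R) :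
  seq_compact X -> continuous_on X h -> seq_compact (fun z => X z /\ h z = y).
Proof.
  intros HX Hh u Hu.
  destruct (HX u (fun n => proj1 (Hu n))) as [phi [l [Hphi [Hl Hlim]]]].
  exists phi, l. repeat split; try assumption.
  apply NNPP. intros Hne.
  assert (Hpos : 0 < Rabs (y - h l)) by (apply Rabs_pos_lt; intros E; apply Hne; lra).
  destruct (Hh l Hl _ Hpos) as [del [Hdel Hcont]].
  destruct (Hlim del Hdel) as [N HN].
  specialize (Hcont (u (phi N)) (proj1 (Hu _)) (HN N (Nat.le_refl N))).
  rewrite (proj2 (Hu _)) in Hcont. lra.
Qed.

Lemma Cmod_minus_continuous_on (X : C -> Prop) (z0 : C) :
  continuous_on X (fun z => Cmod (z - z0)%C).
Proof.
  intros z Hz eps He. exists eps. split; [assumption|]. intros w Hw Hd.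
  eapply Rle_lt_trans; [apply Cmod_minus_abs|].
  replace (w - z0 - (z - z0))%C with (w - z)%C by ring. exact Hd.
Qed.

Lemma closed_disk_seq_compact (z0 : C) (r : R) :
  seq_compact (fun z => Cmod (z - z0)%C <= r).
Proof.
  intros u Hu.
  destruct (bounded_C_subsequence u (Cmod z0 + r)) as [phi [l [Hphi Hl]]].
  { intros n. pose proof (Cmod_le_minus (u n) z0). specialize (Hu n). simpl in Hu. lra. }
  exists phi, l. split; [assumption|]. split; [|assumption].
  apply le_epsilon. intros eps He. destruct (Hl eps He) as [N HN].
  specialize (HN N (Nat.le_refl N)). specialize (Hu (phi N)). simpl in Hu.
  pose proof (Cmod_minus_triangle l (u (phi N)) z0) as T.
  rewrite (Cmod_minus_sym l (u (phi N))) in T. lra.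
Qed.

(** Among the maximizers of [|g|] take one, [z1], at the greatest distance from
    the center.  If it were interior, then either [g] would be constant near
    [z1], giving maximizers further out, or [|g|] would exceed its maximum
    nearby. *)
Lemma maximum_modulus (g : C -> C) (z0 : C) (r L : R) :
  0 <= r ->
  (forall z, Cmod (z - z0)%C <= r -> has_order_from 1 (fun x => g x - g z)%C z) ->
  (forall z, Cmod (z - z0)%C = r -> Cmod (g z) <= L) ->
  forall z, Cmod (z - z0)%C <= r -> Cmod (g z) <= L.
Proof.
  intros Hr Hg HL.
  set (X := fun z => Cmod (z - z0)%C <= r).
  assert (HX : seq_compact X) by apply closed_disk_seq_compact.
  assert (Hcont : continuous_on X (fun z => Cmod (g z))).
  { intros z Hz eps He.
    destruct (has_order_from_continuous _ _ eps (Hg z Hz) He) as [del [Hdel H]].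
    exists del. split; [assumption|]. intros w Hw Hd.
    eapply Rle_lt_trans; [apply Cmod_minus_abs | now apply H]. }
  assert (Hne : X z0).
  { unfold X. replace (z0 - z0)%C with (RtoC 0) by ring. now rewrite Cmod_0. }
  destruct (seq_compact_maximum X _ HX Hcont (ex_intro _ z0 Hne)) as [m [Hm Hmax]].
  destruct (seq_compact_maximum _ (fun z => Cmod (z - z0)%C)
              (seq_compact_level X _ (Cmod (g m)) HX Hcont)
              (Cmod_minus_continuous_on _ z0)
              (ex_intro _ m (conj Hm eq_refl))) as [z1 [[Hz1 Ez1] Hfar]].
  rewrite <- Ez1 in Hmax.
  intros z Hz. eapply Rle_trans; [now apply Hmax|].
  destruct (Rle_lt_or_eq_dec _ _ Hz1) as [Hlt | Heq]; [exfalso | now apply HL].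
  set (gap := r - Cmod (z1 - z0)%C). assert (Hgap : 0 < gap) by (unfold gap; lra).
  assert (Hin : forall x, disk z1 gap x -> X x).
  { intros x Hx. unfold disk, gap in Hx. unfold X.
    pose proof (Cmod_minus_triangle x z1 z0). lra. }
  destruct (Hg z1 Hz1) as [[del [Hdel Hconst]] | [k [c [Hk [Hc Hlead]]]]].
  - (* Points further out come from the growth lemma applied to [x - z0],
       whose expansion at [z1] is exactly linear. *)
    destruct (modulus_exceeded_nearby (fun x => x - z0)%C z1 1 (RtoC 1) (Rmin del gap))
      as [x [Hx Hout]].
    + lia.
    + intros E. apply (f_equal Cmod) in E. rewrite Cmod_1, Cmod_0 in E. lra.
    + exists 0, 1. split; [lra|]. intros x _.
      replace (x - z0 - (z1 - z0) - 1 * (x - z1) ^ 1)%C with (RtoC 0) by (simpl; ring).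
      rewrite Cmod_0. lra.
    + now apply Rmin_glb_lt.
    + unfold disk in Hx. pose proof (Rmin_l del gap). pose proof (Rmin_r del gap).
      assert (Hgx : g x = g z1).
      { specialize (Hconst x ltac:(unfold disk; lra)).
        replace (g x) with ((g x - g z1) + g z1)%C by ring. rewrite Hconst. ring. }
      specialize (Hfar x). rewrite Hgx in Hfar.
      specialize (Hfar (conj (Hin x ltac:(unfold disk; lra)) Ez1)). lra.
  - destruct (modulus_exceeded_nearby g z1 k c gap Hk Hc Hlead Hgap) as [x [Hx Hbig]].
    specialize (Hmax x (Hin x Hx)). lra.
Qed.

(** * The uniform Lipschitz estimate *)

Lemma is_pseries_center (a : nat -> C) (f : C -> C) (z0 : C) (r : R) :
  0 < r ->
  (forall z, disk z0 r z ->
     @is_pseries C_AbsRing C_NormedModule a (z - z0)%C (f z)) ->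
  a O = f z0.
Proof.
  intros Hr Hf. destruct (pseries_remainder a f z0 r Hr Hf O) as [B HB].
  specialize (HB z0 (disk_center z0 (r / 4) ltac:(lra))).
  unfold partial_sum in HB. rewrite sum_O in HB.
  replace (z0 - z0)%C with (RtoC 0) in HB by ring.
  rewrite Cmod_0 in HB. rewrite pow_i, Rmult_0_r in HB by lia.
  replace (f z0 - a O * 0 ^ 0)%C with (f z0 - a O)%C in HB by (simpl; ring).
  assert (E : (f z0 - a O)%C = RtoC 0)
    by (apply Cmod_eq_0, Rle_antisym; [assumption | apply Cmod_ge_0]).
  replace (f z0) with ((f z0 - a O) + a O)%C by ring. rewrite E. ring.
Qed.

Lemma analytic_linearization (Omega : C -> Prop) (f : C -> C) (z1 : C) :
  analytic Omega f -> Omega z1 ->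
  exists d, has_order_from 2 (fun z => f z - f z1 - d * (z - z1))%C z1.
Proof.
  intros Hf Hz1. destruct (Hf z1 Hz1) as [r [Hr [_ [a Ha]]]]. exists (a 1%nat).
  eapply has_order_from_ext; [|apply (pseries_tail_order a f z1 r 1 Hr Ha)].
  intros z. cbv beta. rewrite partial_sum_S. unfold partial_sum. rewrite sum_O.
  rewrite (is_pseries_center a f z1 r Hr Ha). simpl. ring.
Qed.

(** A form of Schwarz's lemma: the maximum modulus principle is applied to the
    difference quotient of [f] at [w] on the disk of radius [3 r / 4], half-way
    between the disk of radius [r / 2] containing [z] and [w] and the given one. *)
Lemma analytic_lipschitz (Omega : C -> Prop) (f : C -> C) (z0 : C) (r M : R) :
  analytic Omega f -> 0 < r -> subset (disk z0 r) Omega ->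
  (forall z, disk z0 r z -> Cmod (f z) <= M) ->
  forall z w, disk z0 (r / 2) z -> disk z0 (r / 2) w ->
    Cmod (f z - f w)%C <= 8 * M / r * Cmod (z - w)%C.
Proof.
  intros Hf Hr Hsub HM z w Hz Hw. unfold disk in Hz, Hw.
  destruct (analytic_linearization Omega f w Hf ltac:(apply Hsub; unfold disk; lra)) as [d Hd].
  (* Adding and subtracting the derivative [d] fills the removable singularity:
     at [x = w] the fraction is [0 / 0 = 0], so that [g w = d]. *)
  set (g := fun x => (d + (f x - f w - d * (x - w)) / (x - w))%C).
  assert (Hgw : g w = d) by (unfold g, Cdiv; ring).
  assert (Hgx : forall x, x <> w -> g x = ((f x - f w) / (x - w))%C).
  { intros x Hx. unfold g. field. now apply Cminus_eq_contra. }
  assert (Hbound : Cmod (g z) <= 8 * M / r).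
  { apply (maximum_modulus g z0 (3 * r / 4)); [lra | | | lra].
    - intros x Hx.
      destruct (classic (x = w)) as [-> | Hxw].
      + eapply has_order_from_ext; [|apply (has_order_from_div_here 1 _ w (Nat.le_refl 1) Hd)].
        intros y. cbv beta. rewrite Hgw. unfold g. ring.
      + destruct (analytic_linearization Omega f x Hf
                    ltac:(apply Hsub; unfold disk; lra)) as [e He].
        (* Away from [w], [g y - g x] is [f y - f x - g x * (y - x)] over
           [y - w], and that numerator is an order 2 remainder plus a linear
           term. *)
        apply (has_order_from_add_linear _ x (e - g x)%C) in He.
        apply (has_order_from_div_away 1 _ x w Hxw) in He.
        refine (has_order_from_ext_near 1 _ _ x (Cmod (x - w)%C) _ _ He).
        * apply Cmod_gt_0. now apply Cminus_eq_contra.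
        * intros y Hy. cbv beta. unfold disk in Hy. rewrite Cmod_minus_sym in Hy.
          assert (Hyw : y <> w) by (intros ->; lra).
          rewrite (Hgx y Hyw), (Hgx x Hxw). field.
          split; now apply Cminus_eq_contra.
    - intros x Hx.
      pose proof (Cmod_minus_triangle x w z0).
      assert (Hxw : r / 4 <= Cmod (x - w)%C) by lra.
      assert (Hne : (x - w)%C <> RtoC 0) by (apply Cmod_gt_0; lra).
      rewrite Hgx by (intros E; apply Hne; rewrite E; ring).
      rewrite Cmod_div by assumption.
      pose proof (HM x ltac:(unfold disk; lra)). pose proof (HM w ltac:(unfold disk; lra)).
      assert (Cmod (f x - f w)%C <= 2 * M).
      { unfold Cminus. eapply Rle_trans; [apply Cmod_triangle|]. rewrite Cmod_opp. lra. }
      apply Rle_trans with (2 * M * (4 / r)); [|right; field; lra].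
      apply Rmult_le_compat; [apply Cmod_ge_0 | left; apply Rinv_0_lt_compat; lra | assumption |].
      replace (4 / r) with (/ (r / 4)) by (field; lra). apply Rinv_le_contravar; lra. }
  destruct (classic (z = w)) as [-> | Hne].
  { replace (f w - f w)%C with (RtoC 0) by ring. replace (w - w)%C with (RtoC 0) by ring.
    rewrite Cmod_0. lra. }
  rewrite (Hgx z Hne), Cmod_div in Hbound by now apply Cminus_eq_contra.
  assert (Hpos : 0 < Cmod (z - w)%C) by (apply Cmod_gt_0; now apply Cminus_eq_contra).
  apply (Rmult_le_compat_r _ _ _ (Rlt_le _ _ Hpos)) in Hbound.
  replace (Cmod (f z - f w)%C / Cmod (z - w)%C * Cmod (z - w)%C)
    with (Cmod (f z - f w)%C) in Hbound by (field; lra). exact Hbound.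
Qed.

(** * Local equicontinuity and compactness *)

(** How covers are used: a property weakening with its index which
    holds near each point for some index holds on a compact set for the largest
    index in a finite subcover.  The index stands for [1 / delta] in
    equicontinuity and for the rank in uniform convergence. *)
Lemma compact_set_uniform_index (K : C -> Prop) (Q : nat -> C -> Prop) :
  compact_set K ->
  (forall n m z, (n <= m)%nat -> Q n z -> Q m z) ->
  (forall z0, K z0 -> exists r n, 0 < r /\ forall z, disk z0 r z -> Q n z) ->
  exists n, forall z, K z -> Q n z.
Proof.
  intros HK Hmono Hloc.
  destruct (HK (fun V => open V /\ exists n, forall z, V z -> Q n z)) as [l [Hl Hcov]].
  - now intros V [HV _].
  - intros z Hz. destruct (Hloc z Hz) as [r [n [Hr Hn]]].
    exists (disk z r). split; [|now apply disk_center].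
    split; [apply open_disk | now exists n].
  - assert (Hmax : exists n, forall V, In V l -> forall z, V z -> Q n z).
    { clear Hcov. induction l as [|V l IH]; [exists O; now intros V []|].
      destruct IH as [n Hn]; [intros W HW; apply Hl; now right|].
      destruct (Hl V (or_introl eq_refl)) as [_ [m Hm]].
      exists (Nat.max n m). intros W [<- | HW] z Hz.
      - apply (Hmono m); [lia | now apply Hm].
      - apply (Hmono n); [lia | now apply (Hn W)]. }
    destruct Hmax as [n Hn]. exists n. intros z Hz.
    destruct (Hcov z Hz) as [V [HV HVz]]. exact (Hn V HV z HVz).
Qed.

Definition locally_equicontinuous (Omega : C -> Prop) (F : (C -> C) -> Prop) : Prop :=
  forall z0, Omega z0 -> forall eps, 0 < eps ->
    exists rho, 0 < rho /\ subset (disk z0 rho) Omega /\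
      forall f z w, F f -> disk z0 rho z -> disk z0 rho w -> Cmod (f z - f w)%C < eps.

(** If the oscillation is below [eps] on the disk of radius [rho], then any
    [delta <= rho / 2] works for all points of the disk of radius [rho / 2]. *)
Lemma locally_equicontinuous_on_compact (Omega : C -> Prop) (F : (C -> C) -> Prop)
    (K : C -> Prop) :
  locally_equicontinuous Omega F -> compact_set K -> subset K Omega ->
  equicontinuous_on K F.
Proof.
  intros HF HK Hsub eps He.
  assert (Hpos : forall n, 0 < / (INR n + 1)).
  { intros n. apply Rinv_0_lt_compat. pose proof (pos_INR n). lra. }
  destruct (compact_set_uniform_index K
              (fun n z => forall f w, F f -> Cmod (z - w)%C < / (INR n + 1) ->
                                      Cmod (f z - f w)%C < eps) HK) as [n Hn].
  - intros n m z Hnm H f w Hf Hzw. apply H; [assumption|].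
    eapply Rlt_le_trans; [exact Hzw|]. apply Rinv_le_contravar.
    + pose proof (pos_INR n). lra.
    + apply le_INR in Hnm. lra.
  - intros z0 Hz0. destruct (HF z0 (Hsub z0 Hz0) eps He) as [rho [Hrho [_ H]]].
    destruct (inv_INR_lt (rho / 2) ltac:(lra)) as [N HN].
    specialize (HN N (Nat.le_refl N)).
    exists (rho / 2), N. split; [lra|]. intros z Hz f w Hf Hzw.
    unfold disk in Hz. apply H; [assumption | unfold disk; lra |].
    unfold disk. pose proof (Cmod_minus_triangle w z z0) as T.
    rewrite (Cmod_minus_sym w z) in T. lra.
  - exists (/ (INR n + 1)). split; [apply Hpos|].
    intros f z w Hf Hz _ Hzw. now apply Hn.
Qed.

(** * A countable dense set *)

Definition grid_coordinate (p m : nat) : R :=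
  let (a, b) := Cantor.of_nat p in (INR a - INR b) / (INR m + 1).

(** An enumeration of the complex numbers with rational parts: [p] and [q] code
    the two numerators, each as a difference of naturals, and [m + 1] is the
    common denominator. *)
Definition grid_point (j : nat) : C :=
  let (pq, m) := Cantor.of_nat j in
  let (p, q) := Cantor.of_nat pq in
  (grid_coordinate p m, grid_coordinate q m).

Lemma grid_coordinate_dense (x : R) (m : nat) :
  exists p, Rabs (grid_coordinate p m - x) <= / (INR m + 1).
Proof.
  pose proof (pos_INR m). set (s := INR m + 1). assert (Hs : 0 < s) by (unfold s; lra).
  destruct (archimed (x * s)) as [H1 H2]. set (k := up (x * s)) in *.
  assert (E : exists a b, INR a - INR b = IZR k).
  { destruct (Z.le_ge_cases 0 k) as [Hk | Hk].
    - exists (Z.to_nat k), O. rewrite INR_IZR_INZ, Z2Nat.id by assumption. simpl. lra.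
    - exists O, (Z.to_nat (- k)). rewrite (INR_IZR_INZ (Z.to_nat (- k))), Z2Nat.id by lia.
      rewrite opp_IZR. simpl. lra. }
  destruct E as [a [b E]]. exists (Cantor.to_nat (a, b)).
  unfold grid_coordinate. rewrite Cantor.cancel_of_to. fold s. rewrite E.
  replace (IZR k / s - x) with ((IZR k - x * s) * / s) by (field; lra).
  rewrite Rabs_mult, (Rabs_pos_eq (/ s)) by (left; now apply Rinv_0_lt_compat).
  rewrite <- (Rmult_1_l (/ s)) at 2. apply Rmult_le_compat_r.
  - left; now apply Rinv_0_lt_compat.
  - apply Rabs_le_between. lra.
Qed.

Lemma grid_point_dense (z : C) (r : R) : 0 < r -> exists j, disk z r (grid_point j).
Proof.
  intros Hr. destruct (inv_INR_lt (r / 2) ltac:(lra)) as [m Hm].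
  specialize (Hm m (Nat.le_refl m)).
  destruct (grid_coordinate_dense (Re z) m) as [p Hp].
  destruct (grid_coordinate_dense (Im z) m) as [q Hq].
  exists (Cantor.to_nat (Cantor.to_nat (p, q), m)).
  unfold grid_point. rewrite !Cantor.cancel_of_to.
  unfold disk. eapply Rle_lt_trans; [apply Cmod_le_Re_Im|].
  unfold Re, Im, Cminus, Cplus, Copp, Rminus in *; simpl. lra.
Qed.

(** * The Arzela-Ascoli theorem and Montel's theorem *)

Lemma Cauchy_seq_limit (u : nat -> C) :
  (forall eps, 0 < eps -> exists N, forall n m, (N <= n)%nat -> (N <= m)%nat ->
     Cmod (u n - u m)%C < eps) ->
  exists l, seq_limit u l.
Proof.
  intros Hu.
  destruct (Rcomplete.R_complete (fun n => Re (u n))) as [x Hx].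
  { intros eps He. destruct (Hu eps He) as [N HN]. exists N. intros n m Hn Hm.
    eapply Rle_lt_trans; [|apply (HN n m); assumption].
    apply (re_le_Cmod (u n - u m)%C). }
  destruct (Rcomplete.R_complete (fun n => Im (u n))) as [y Hy].
  { intros eps He. destruct (Hu eps He) as [N HN]. exists N. intros n m Hn Hm.
    eapply Rle_lt_trans; [|apply (HN n m); assumption].
    apply (Im_le_Cmod (u n - u m)%C). }
  exists (x, y). intros eps He.
  destruct (Hx (eps / 2) ltac:(lra)) as [N1 H1].
  destruct (Hy (eps / 2) ltac:(lra)) as [N2 H2].
  exists (Nat.max N1 N2). intros n Hn.
  specialize (H1 n ltac:(lia)). specialize (H2 n ltac:(lia)).
  eapply Rle_lt_trans; [apply Cmod_le_Re_Im|].
  unfold Rdist, Re, Im, Cminus, Cplus, Copp, Rminus in *; simpl in *. lra.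
Qed.

(** Convergence at one grid point [q] in a disk where the oscillation of the
    family is small makes the sequence uniformly Cauchy on that disk, by
    comparison of [u n z] and [u m z] through [q]. *)
Lemma Arzela_Ascoli (Omega : C -> Prop) (F : (C -> C) -> Prop) :
  locally_equicontinuous Omega F ->
  (forall z, Omega z -> exists M, forall f, F f -> Cmod (f z) <= M) ->
  normal Omega F.
Proof.
  intros HF Hbd u Hu.
  (* Outside [Omega] the family need not be bounded; there the grid values are
     replaced by [0]. *)
  set (v := fun j n => if excluded_middle_informative (Omega (grid_point j))
                       then u n (grid_point j) else RtoC 0).
  destruct (diagonal_subsequence v) as [phi [Hphi Hlim]].
  { intros j. unfold v. destruct (excluded_middle_informative _) as [Hj | Hj].
    - destruct (Hbd _ Hj) as [M HM]. exists M. intros n. apply HM, Hu.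
    - exists 0. intros n. rewrite Cmod_0. apply Rle_refl. }
  assert (Hcauchy : forall z0, Omega z0 -> forall eps, 0 < eps ->
            exists r N, 0 < r /\ forall z, disk z0 r z -> forall n m,
              (N <= n)%nat -> (N <= m)%nat ->
              Cmod (u (phi n) z - u (phi m) z)%C < eps).
  { intros z0 Hz0 eps He.
    destruct (HF z0 Hz0 (eps / 4) ltac:(lra)) as [rho [Hrho [Hsub H]]].
    destruct (grid_point_dense z0 rho Hrho) as [j Hj].
    destruct (Hlim j) as [l Hl]. unfold v in Hl.
    destruct (excluded_middle_informative _) as [HO | HO]; [|elim HO; now apply Hsub].
    destruct (Hl (eps / 4) ltac:(lra)) as [N HN].
    exists rho, N. split; [assumption|]. intros z Hz n m Hn Hm.
    set (q := grid_point j) in *.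
    pose proof (H (u (phi n)) z q (Hu _) Hz Hj).
    pose proof (H (u (phi m)) q z (Hu _) Hj Hz).
    pose proof (HN n Hn). pose proof (HN m Hm) as Hm'. simpl in Hm'.
    rewrite Cmod_minus_sym in Hm'.
    pose proof (Cmod_minus_triangle (u (phi n) z) (u (phi n) q) (u (phi m) z)).
    pose proof (Cmod_minus_triangle (u (phi n) q) l (u (phi m) z)).
    pose proof (Cmod_minus_triangle l (u (phi m) q) (u (phi m) z)).
    lra. }
  assert (Hpt : forall z, exists l, Omega z -> seq_limit (fun n => u (phi n) z) l).
  { intros z. destruct (classic (Omega z)) as [Hz | Hz]; [|exists (RtoC 0); now intros].
    destruct (Cauchy_seq_limit (fun n => u (phi n) z)) as [l Hl]; [|now exists l].
    intros eps He. destruct (Hcauchy z Hz eps He) as [r [N [Hr H]]].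
    exists N. intros n m Hn Hm. apply (H z); try assumption. now apply disk_center. }
  destruct (choice _ Hpt) as [f Hf].
  exists phi, f. split; [exact Hphi|]. intros K HK Hsub eps He.
  destruct (compact_set_uniform_index K
              (fun N z => forall n m, (N <= n)%nat -> (N <= m)%nat ->
                            Cmod (u (phi n) z - u (phi m) z)%C < eps / 2) HK) as [N HN].
  - intros n m z Hnm H i j Hi Hj. apply H; lia.
  - intros z0 Hz0. apply Hcauchy; [now apply Hsub | lra].
  - exists N. intros n z Hn Hz.
    destruct (Hf z (Hsub z Hz) (eps / 2) ltac:(lra)) as [N' HN'].
    set (m := Nat.max N N').
    specialize (HN' m ltac:(lia)). specialize (HN z Hz n m Hn ltac:(lia)).
    pose proof (Cmod_minus_triangle (u (phi n) z) (u (phi m) z) (f z)). simpl in HN'. lra.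
Qed.

Lemma locally_bounded_equicontinuous (Omega : C -> Prop) (F : (C -> C) -> Prop) :
  (forall f, F f -> analytic Omega f) -> locally_bounded Omega F ->
  locally_equicontinuous Omega F.
Proof.
  intros HF Hbd z0 Hz0 eps He.
  destruct (Hbd z0 Hz0) as [r [M [Hr [Hsub HM]]]].
  (* The absolute value and [+ 1] keep the constant positive, whatever [M]. *)
  set (L := Rabs (8 * M / r) + 1).
  assert (HL : 0 < L) by (unfold L; pose proof (Rabs_pos (8 * M / r)); lra).
  assert (Hq : 0 < eps / (2 * L)) by (apply Rdiv_lt_0_compat; lra).
  exists (Rmin (r / 2) (eps / (2 * L))).
  pose proof (Rmin_l (r / 2) (eps / (2 * L))). pose proof (Rmin_r (r / 2) (eps / (2 * L))).
  split; [apply Rmin_glb_lt; lra|]. split.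
  { intros z Hz. apply Hsub. unfold disk in *. lra. }
  intros f z w Hf Hz Hw. unfold disk in Hz, Hw.
  eapply Rle_lt_trans.
  { apply (analytic_lipschitz Omega f z0 r M (HF f Hf) Hr Hsub); [|unfold disk; lra ..].
    intros x Hx. now apply HM. }
  pose proof (Cmod_minus_triangle z z0 w) as T. rewrite (Cmod_minus_sym z0 w) in T.
  assert (Hzw : Cmod (z - w)%C < 2 * (eps / (2 * L))) by lra.
  pose proof (Cmod_ge_0 (z - w)%C).
  apply Rle_lt_trans with (L * Cmod (z - w)%C).
  - apply Rmult_le_compat_r; [assumption|]. unfold L. pose proof (Rle_abs (8 * M / r)). lra.
  - apply (Rmult_lt_compat_l L) in Hzw; [|assumption].
    replace (L * (2 * (eps / (2 * L)))) with eps in Hzw by (field; lra). exact Hzw.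
Qed.

Theorem theorem12p3 (Omega : C -> Prop) (F : (C -> C) -> Prop)
    (hOmega : open Omega)
    (hF : forall f : C -> C, F f -> analytic Omega f)
    (hbdd : locally_bounded Omega F) :
  (forall K : C -> Prop, compact_set K -> subset K Omega ->
     equicontinuous_on K F) /\
  normal Omega F.
Proof.
  pose proof (locally_bounded_equicontinuous Omega F hF hbdd) as Heq.
  split.
  - intros K HK Hsub. now apply (locally_equicontinuous_on_compact Omega).
  - apply Arzela_Ascoli; [exact Heq|].
    intros z Hz. destruct (hbdd z Hz) as [r [M [Hr [_ HM]]]].
    exists M. intros f Hf. apply HM; [assumption | now apply disk_center].
Qed.
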